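(* For every integer $n \ge 3$, there exist infinitely many (pairwise non-isomorphic) $[P_n]$-irregular graphs, where $P_n$ is the path with $n$ vertices.
   Context: All graphs are simple, finite and undirected. $P_n$ denotes the path of order $n$ (a graph with $n$ distinct vertices $u_1,\dots,u_n$ and edges exactly $u_iu_{i+1}$, $1\le i\le n-1$). For graphs $F$ and $G$, the $[F]$-degree of a vertex $v$ of $G$ is the number of induced subgraphs of $G$ that are isomorphic to $F$ and contain $v$ (equivalently, the number of vertex subsets $S \ni v$ such that the subgraph of $G$ induced by $S$ is isomorphic to $F$). A graph $G$ is $[F]$-irregular if the $[F]$-degrees of its vertices are pairwise distinct. *)

(* Defs.v *)
From mathcomp Require Import all_boot.
Set Implicit Arguments.
Unset Strict Implicit.
Unset Printing Implicit Defensive.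

Record sgraph := SGraph {
  vertex :> finType;
  adj : rel vertex;
  adj_sym : symmetric adj;
  adj_irrefl : irreflexive adj }.

Definition isomorphic (F G : sgraph) : Prop :=
  exists f : F -> G, bijective f /\ forall x y, adj (f x) (f y) = adj x y.

(* Boolean form of [isomorphic], needed to form a [{set _}] of induced copies;
   the two agree by [isomorphicP] below. *)
Definition isomorphicb (F G : sgraph) : bool :=
  [exists f : {ffun F -> G},
    [&& injectiveb f, [forall y, y \in codom f] &
        [forall x, forall y, adj (f x) (f y) == adj x y]]].

Lemma isomorphicP (F G : sgraph) : reflect (isomorphic F G) (isomorphicb F G).
Proof.
apply: (iffP existsP) => [[f /and3P[/injectiveP injf /forallP surjf adjf]]|].
  exists f; split=> [|x y]; last by have /forallP/(_ x)/forallP/(_ y)/eqP := adjf.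
  by exists (fun y => iinv (surjf y)) => y; [exact: iinv_f | exact: f_iinv].
case=> f [[g fK gK] adjf]; exists (finfun f); apply/and3P; split.
- by apply/injectiveP=> x y; rewrite !ffunE; apply: can_inj fK x y.
- apply/forallP=> y; apply/codomP; exists (g y); by rewrite ffunE gK.
- by apply/forallP=> x; apply/forallP=> y; rewrite !ffunE adjf.
Qed.

Section Induced.
Variables (G : sgraph) (S : {set G}).

Definition induced_adj : rel {x : G | x \in S} :=
  fun x y => adj (val x) (val y).

Lemma induced_adj_sym : symmetric induced_adj.
Proof. by move=> x y; apply: adj_sym. Qed.

Lemma induced_adj_irrefl : irreflexive induced_adj.
Proof. by move=> x; apply: adj_irrefl. Qed.

Definition induced : sgraph := SGraph induced_adj_sym induced_adj_irrefl.

End Induced.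

Section Path.
Variable n : nat.

Definition path_adj : rel 'I_n := fun i j => (i.+1 == j) || (j.+1 == i).

Lemma path_adj_sym : symmetric path_adj.
Proof. by move=> i j; rewrite /path_adj orbC. Qed.

Lemma path_adj_irrefl : irreflexive path_adj.
Proof. by move=> i; rewrite /path_adj orbb gtn_eqF. Qed.

Definition path_graph : sgraph := SGraph path_adj_sym path_adj_irrefl.

End Path.

Definition sub_degree (F G : sgraph) (v : G) : nat :=
  #|[set S : {set G} | (v \in S) && isomorphicb F (induced S)]|.

Definition irregular (F G : sgraph) : Prop :=
  forall u v : G, u <> v -> sub_degree F u <> sub_degree F v.

(* Main.v *)
Require Import Defs.
From mathcomp Require Import all_boot.
From mathcomp Require Import zify.

(* Take a half graph on A = {a_0, ..., a_K} and B = {b_0, ..., b_(K-1)}, with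
   a_k adjacent to b_j iff j < k, and attach a path P by its end p_0 to all of A
   and a path Q by its end q_0 to all of B.

   For n >= 4, take |P| = n - 1, |Q| = n - 2, make A a clique, and make B a
   clique unless n = 4.  An induced P_n then meets the half graph in one of four
   ways: an edge a b, extended by p's and q's on both sides (n - 1 ways); a
   single vertex of A, followed by all of P; or three vertices a b b' or a' a b,
   extended in the unique possible way.  The numbers of three-vertex traces
   through a vertex are quadratic in its index, but their sum over the two kinds
   is constant, so that with e = K (K + 1) / 2 (the number of edges a b) the
   degree of a_k is 1 + (n-1) k + e and that of b_j is (n-1) (K - j) + e.  Each
   vertex of P or Q has degree r modulo e, plus a multiple of the number of
   three-vertex traces, where r = K + 1 on P and r = 0 on Q.  All degrees are
   distinct as soon as K = 1 modulo n - 1 and K is large.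

   For n = 4 a clique B would create the further paths a' a b b'; an independent
   B replaces the traces p_0 a b b' by a b q_0 b', with the same counts.

   For n = 3, take |P| = |Q| = 1 and A, B independent.  The graph is bipartite,
   so the degree of v is C(d(v), 2) + sum over neighbours y of (d(y) - 1), and
   modulo K + 1 it is K on A, K - 1 on B, 0 at p_0 and 1 at q_0. *)

Set Implicit Arguments.
Unset Strict Implicit.
Unset Printing Implicit Defensive.

(** * Numberings of induced paths *)

Section Numbering.
Variable G : sgraph.

(** [g x] is the position of [x] along the path. Defining [g] on all of [G], with only its values on
    [S] relevant, keeps the subtype of [S] out of the later arguments. *)
Definition numbering (n : nat) (S : {set G}) (g : G -> nat) : Prop :=
  [/\ #|S| = n, {in S, forall x, g x < n}, {in S &, injective g} &
      {in S &, forall x y, adj x y = ((g x).+1 == g y) || ((g y).+1 == g x)}].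

Lemma isomorphic_numbering n (S : {set G}) :
  isomorphic (path_graph n) (induced S) <-> exists g, numbering n S g.
Proof.
split=> [[f [[h fK hK] fadj]]|[g [cardS g_lt g_inj g_adj]]].
- exists (fun x => oapp (fun y : {x | x \in S} => nat_of_ord (h y)) 0 (insub x)).
  have E x (xS : x \in S) : oapp (fun y : {x | x \in S} => nat_of_ord (h y)) 0 (insub x)
      = h (exist _ x xS) by rewrite (insubT (mem S) xS).
  split.
  + have <- : #|{: {x | x \in S}}| = n.
      by rewrite (bij_eq_card (Bijective hK fK)) card_ord.
    by rewrite card_sig; apply: eq_card => x; rewrite inE.
  + by move=> x xS; rewrite E.
  + move=> x y xS yS; rewrite !E => /val_inj /(can_inj hK) [].
    exact.
  + move=> x y xS yS; rewrite !E.
    by have := fadj (h (exist _ x xS)) (h (exist _ y yS)); rewrite !hK.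
- have hlt (x : induced S) : g (val x) < n by apply: g_lt; exact: (valP x).
  pose h (x : induced S) : path_graph n := Ordinal (hlt x).
  have h_inj : injective h.
    by move=> x y [/g_inj] E; apply/val_inj/E; apply: valP.
  have [f fK hK] : bijective h.
    apply: inj_card_bij => //; rewrite card_ord card_sig -cardS.
    by apply/eq_leq/eq_card => x; rewrite inE.
  exists f; split; first by exists h.
  move=> x y; rewrite -{2}[x]hK -{2}[y]hK /= /induced_adj /path_adj.
  by rewrite g_adj //; apply: valP.
Qed.

Lemma numbering_surj n (S : {set G}) g i :
  numbering n S g -> i < n -> exists2 x, x \in S & g x = i.
Proof.
move=> [cardS g_lt g_inj _] lt_in.
pose h (x : G) : 'I_n := insubd (Ordinal lt_in) (g x).
have hE x : x \in S -> val (h x) = g x.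
  by move=> xS; rewrite /h val_insubd g_lt.
have h_inj : {in S &, injective h}.
  by move=> x y xS yS /(congr1 val); rewrite !hE //; apply: g_inj.
have im : h @: S = [set: 'I_n].
  by apply/eqP; rewrite eqEcard subsetT cardsT card_ord card_in_imset ?cardS ?leqnn.
have /imsetP [x xS /(congr1 val)] : Ordinal lt_in \in h @: S by rewrite im inE.
rewrite hE //= => ->; by exists x.
Qed.

(** This is connectivity of the path: walking through the positions between [x] and [y], some step
    crosses the boundary of [U]. *)
Lemma numbering_cut n (S : {set G}) g (U : pred G) x y :
  numbering n S g -> x \in S -> U x -> y \in S -> ~~ U y ->
  exists u w, [/\ u \in S, U u, w \in S, ~~ U w & adj u w].
Proof.
move=> gP xS Ux yS Uy; have [_ g_lt g_inj g_adj] := gP.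
(* If [y] precedes [x], the complement of [U] is taken and the two ends are exchanged. *)
wlog lt_xy : U x y xS Ux yS Uy / g x < g y => [IH|].
  case: (ltngtP (g x) (g y)) => [|lt_yx|/g_inj E]; first exact: IH.
    case: (IH (fun z => ~~ U z) y x) => //; first by rewrite negbK.
    move=> u [w [uS Uu wS]]; rewrite negbK => Uw auw.
    by exists w, u; split=> //; rewrite adj_sym.
  by move: Uy; rewrite -E ?Ux.
have [d] := ubnP (g y - g x); elim: d x xS Ux lt_xy => // d IH x xS Ux lt_xy ltd.
have [z zS gz] := numbering_surj gP (leq_ltn_trans lt_xy (g_lt y yS)).
have axz : adj x z by rewrite g_adj // gz eqxx.
case Uz: (U z); last by exists x, z; rewrite Uz.
apply: (IH z) => //; last by lia.
have : g z <> g y by move/g_inj => E; move: Uy; rewrite -E ?Uz.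
lia.
Qed.

(** Adjacent positions have opposite parity. This lemma and the next two supply the forbidden
    configurations of the classification. *)
Lemma numbering_no_triangle n (S : {set G}) g x y z :
  numbering n S g -> x \in S -> y \in S -> z \in S ->
  adj x y -> adj y z -> adj x z -> False.
Proof. by move=> [_ _ _ g_adj] xS yS zS; rewrite !g_adj //; lia. Qed.

Lemma numbering_deg2 n (S : {set G}) g v x y z :
  numbering n S g -> v \in S -> x \in S -> y \in S -> z \in S ->
  adj v x -> adj v y -> adj v z -> x != y -> y != z -> x != z -> False.
Proof.
move=> [_ _ g_inj g_adj] vS xS yS zS; rewrite !g_adj // => vx vy vz.
move=> /eqP xy /eqP yz /eqP xz.
have nxy : g x <> g y by move/g_inj => E; apply: xy; apply: E.
have nyz : g y <> g z by move/g_inj => E; apply: yz; apply: E.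
have nxz : g x <> g z by move/g_inj => E; apply: xz; apply: E.
lia.
Qed.

(** Two distinct positions have at most one common neighbour. *)
Lemma numbering_no_square n (S : {set G}) g x y z w :
  numbering n S g -> x \in S -> y \in S -> z \in S -> w \in S ->
  adj x y -> adj y z -> adj z w -> adj w x -> x != z -> y != w -> False.
Proof.
move=> [_ _ g_inj g_adj] xS yS zS wS; rewrite !g_adj // => xy yz zw wx.
move=> /eqP xz /eqP yw.
have nxz : g x <> g z by move/g_inj => E; apply: xz; apply: E.
have nyw : g y <> g w by move/g_inj => E; apply: yw; apply: E.
lia.
Qed.

End Numbering.

(** * The graphs and their induced paths *)

Section Graph.
Variables (cliqueA cliqueB : bool) (K t t' : nat).

Definition gvertex : finType := (('I_K.+1 + 'I_K) + ('I_t + 'I_t'))%type.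

Definition gadj : rel gvertex := fun u v =>
  match u, v with
  | inl (inl a), inl (inl a') => cliqueA && (a != a' :> nat)
  | inl (inr b), inl (inr b') => cliqueB && (b != b' :> nat)
  | inl (inl a), inl (inr b) | inl (inr b), inl (inl a) => b < a
  | inl (inl _), inr (inl l) | inr (inl l), inl (inl _) => l == 0 :> nat
  | inl (inr _), inr (inr l) | inr (inr l), inl (inr _) => l == 0 :> nat
  | inr (inl l), inr (inl l') => (l.+1 == l' :> nat) || (l'.+1 == l :> nat)
  | inr (inr l), inr (inr l') => (l.+1 == l' :> nat) || (l'.+1 == l :> nat)
  | _, _ => false
  end.

Lemma gadj_sym : symmetric gadj.
Proof. by case=> [[a|b]|[l|l]] [[a'|b']|[l'|l']] //=; lia. Qed.

Lemma gadj_irrefl : irreflexive gadj.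
Proof. by case=> [[a|b]|[l|l]] /=; lia. Qed.

Definition graph : sgraph := SGraph gadj_sym gadj_irrefl.

Definition vA (a : 'I_K.+1) : graph := inl (inl a).
Definition vB (b : 'I_K) : graph := inl (inr b).
Definition vP (l : 'I_t) : graph := inr (inl l).
Definition vQ (l : 'I_t') : graph := inr (inr l).

Lemma big_graph (F : graph -> nat) :
  \sum_v F v = \sum_a F (vA a) + \sum_b F (vB b) + (\sum_l F (vP l) + \sum_l F (vQ l)).
Proof. by rewrite big_sumType /= !big_sumType /=. Qed.

Lemma card_graph_set (S : {set graph}) :
  #|S| = #|[set a | vA a \in S]| + #|[set b | vB b \in S]|
         + (#|[set l | vP l \in S]| + #|[set l | vQ l \in S]|).
Proof.
rewrite -!sum1dep_card -sum1_card big_mkcond big_graph.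
by rewrite -!big_mkcond.
Qed.

(** The induced paths to be counted turn out to meet P and Q in initial segments, so two lengths
    describe these parts. *)
Definition block (X : pred nat) (Y : pred nat) (i j : nat) : {set graph} :=
  [set v : graph | match v with
    | inl (inl a) => X a
    | inl (inr b) => Y b
    | inr (inl l) => l < i
    | inr (inr l) => l < j
    end].

End Graph.

Lemma sum_ltn_ord N i (F : nat -> nat) : i <= N -> \sum_(l < N | l < i) F l = \sum_(l < i) F l.
Proof. by move=> le_iN; rewrite (big_ord_widen N F le_iN). Qed.

Lemma card_ltn_ord N i : i <= N -> #|[set l : 'I_N | l < i]| = i.
Proof. by move=> le; rewrite -sum1dep_card (sum_ltn_ord (fun=> 1) le) sum1_card card_ord. Qed.

Lemma card_eq_ord N (x : 'I_N) : #|[set l : 'I_N | l == x :> nat]| = 1.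
Proof. by rewrite -(cards1 x); apply: eq_card => l; rewrite !inE. Qed.

Lemma card_eq2_ord N (x y : 'I_N) : x != y :> nat ->
  #|[set l : 'I_N | (l == x :> nat) || (l == y :> nat)]| = 2.
Proof.
move=> xy; have := cards2 x y; rewrite -val_eqE xy => <-.
by apply: eq_card => l; rewrite !inE.
Qed.

(** * The explicit list of induced paths for [n >= 4] *)

Section Copies.
Variables (m K : nat).
Let n := m.+4.
Let G := graph true (m != 0) K m.+3 m.+2.
Local Notation gblock := (block true (m != 0) K m.+3 m.+2).

Definition copy_index : finType :=
  (('I_m.+3 * 'I_K.+1 * 'I_K + 'I_K.+1 * 'I_K * 'I_K) +
   ('I_K.+1 * 'I_K.+1 * 'I_K + 'I_K.+1))%type.

(** For three-vertex traces the inequalities ask for exactly one of the two possible edges of the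
    half graph. They also order the pair in A or in B, so that no vertex set is listed twice. *)
Definition valid (c : copy_index) : bool :=
  match c with
  | inl (inl (_, a, b)) => b < a
  | inl (inr (a, b, b')) => b < a <= b'
  | inr (inl (a, a', b)) => a' <= b < a
  | inr (inr _) => true
  end.

(* [i] and [m.+2 - i] count the vertices of P and Q; the second case is
   p_m ... p_0 a b b' if [m != 0], and a b q_0 b' if [m == 0]. *)
Definition copy (c : copy_index) : {set G} :=
  match c with
  | inl (inl (i, a, b)) => gblock (xpred1 (a : nat)) (xpred1 (b : nat)) i (m.+2 - i)
  | inl (inr (a, b, b')) => gblock (xpred1 (a : nat)) (xpred2 (b : nat) (b' : nat))
      (if m == 0 then 0 else m.+1) (m == 0)
  | inr (inl (a, a', b)) => gblock (xpred2 (a : nat) (a' : nat)) (xpred1 (b : nat)) 0 m.+1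
  | inr (inr a) => gblock (xpred1 (a : nat)) xpred0 m.+3 0
  end.

(** Positions are counted from the end of the copy farthest along P, or from [a] or [a'] if P is
    avoided. In the second case [b'] comes last and [b] one place before it, or two places if [q_0]
    lies between them. Values off the copy are irrelevant. *)
Definition copy_pos (c : copy_index) (v : G) : nat :=
  match c, v with
  | inl (inl (i, _, _)), inl (inl _) => i
  | inl (inl (i, _, _)), inl (inr _) => i.+1
  | inl (inl (i, _, _)), inr (inl l) => i.-1 - l
  | inl (inl (i, _, _)), inr (inr l) => i.+2 + l
  | inl (inr _), inl (inl _) => (if m == 0 then 0 else m.+1)
  | inl (inr (_, b, _)), inl (inr j) =>
      m.+3 - (j == b :> nat) * (m == 0).+1
  | inl (inr _), inr (inl l) => m - l
  | inl (inr _), inr (inr l) => 2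
  | inr (inl (a, _, _)), inl (inl k) => k == a :> nat
  | inr (inl _), inl (inr _) => 2
  | inr (inl _), inr (inl _) => 0
  | inr (inl _), inr (inr l) => 3 + l
  | inr (inr _), inl (inl _) => m.+3
  | inr (inr _), inr (inl l) => m.+2 - l
  | inr (inr _), _ => 0
  end.

Lemma card_block X Y i j : i <= m.+3 -> j <= m.+2 ->
  #|(gblock X Y i j)| =
    #|[set a : 'I_K.+1 | X a]| + #|[set b : 'I_K | Y b]| + (i + j).
Proof.
move=> le_i le_j; rewrite card_graph_set; congr (_ + _ + (_ + _)).
- by apply: eq_card => a; rewrite !inE.
- by apply: eq_card => a; rewrite !inE.
- by rewrite -{2}(card_ltn_ord le_i); apply: eq_card => a; rewrite !inE.
- by rewrite -{2}(card_ltn_ord le_j); apply: eq_card => a; rewrite !inE.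
Qed.

Lemma card_copy c : valid c -> #|copy c| = n.
Proof.
case: c => [[[[i a] b]|[[a b] b']]|[[[a a'] b]|a]] /= val; rewrite card_block ?card_eq_ord ?card_eq2_ord //.
all: try (try have := ltn_ord i; case: (m =P 0) => /= *; rewrite /n; lia).
by rewrite (_ : [set _ | _] = set0) ?cards0 /n; [lia | apply/setP => b; rewrite !inE].
Qed.

Ltac split_copy c vc := case: c vc => [[[[i a] b]|[[a b] b']]|[[[a a'] b]|a]] /= vc;
  [have ltim := ltn_ord i| | |].

Lemma copy_numbering c : valid c -> numbering n (copy c) (copy_pos c).
Proof.
move=> vc; split; first exact: card_copy.
- by split_copy c vc; case=> [[k|j]|[l|l]]; rewrite inE /n //=;
    case: (m =P 0) => /= m0; lia.
- split_copy c vc; move=> [[k|j]|[l|l]] [[k'|j']|[l'|l']]; rewrite !inE //= => xS yS;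
    try (case: (m =P 0) xS yS => /= m0 xS yS; lia);
    (move=> E; congr (inl _) || congr (inr _)); (congr (inl _) || congr (inr _));
    apply/val_inj; move: E xS yS => /=; case: (m =P 0) => /= m0; lia.
- split_copy c vc; move=> [[k|j]|[l|l]] [[k'|j']|[l'|l']]; rewrite !inE //= => xS yS;
    case: (m =P 0) xS yS => /= m0 xS yS; lia.
Qed.

End Copies.

Lemma initial_segment N (p : pred 'I_N) :
  (forall l l' : 'I_N, l'.+1 = l :> nat -> p l -> p l') ->
  exists2 i, i <= N & forall l, p l = (l < i).
Proof.
move=> p_down.
pose q x := (x == N) || [exists l : 'I_N, (l == x :> nat) && ~~ p l].
have exq : exists x, q x by exists N; rewrite /q eqxx.
case: (ex_minnP exq) => i qi i_min.
have le_iN : i <= N by apply: i_min; rewrite /q eqxx.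
exists i => // l; case: (ltnP l i) => [lt_li|le_il].
  apply: contraLR lt_li => npl; rewrite -leqNgt; apply: i_min.
  by rewrite /q; apply/orP; right; apply/existsP; exists l; rewrite eqxx.
apply/negP => pl.
have pdown d (l' : 'I_N) : l' + d = l -> p l'.
  elim: d l' => [|d IH] l' E; first by rewrite (_ : l' = l) //; apply/val_inj => /=; lia.
  have lt1 : l'.+1 < N by have := ltn_ord l; lia.
  by apply: (p_down (Ordinal lt1)) => //; apply: IH => /=; lia.
case/orP: qi => [/eqP|/existsP [l' /andP [/eqP l'i /negP]]]; last first.
  by apply; apply: (pdown (l - i)); lia.
by have := ltn_ord l; lia.
Qed.

(** * Every induced path of order [n >= 4] is in the list *)

Section Classification.
Variables (m K : nat).
Let n := m.+4.
Let G := graph true (m != 0) K m.+3 m.+2.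
Local Notation uA := (vA true (m != 0) m.+3 m.+2).
Local Notation uB := (vB true (m != 0) m.+3 m.+2).
Local Notation uP := (vP true (m != 0) K m.+2).
Local Notation uQ := (vQ true (m != 0) K m.+3).
Variables (S : {set G}) (g : G -> nat).
Hypothesis gP : numbering n S g.

Let A := [set a | uA a \in S].
Let B := [set b | uB b \in S].

Let cardS : #|S| = n.
Proof. by case: gP. Qed.

(** A piece with fewer than [n] vertices cannot contain the whole path, so the path leaves it along
    an edge. *)
Lemma cut_small N (f : 'I_N -> G) (U : pred G) x :
  N < n -> (forall v, U v -> exists l, v = f l) -> x \in S -> U x ->
  exists u w, [/\ u \in S, U u, w \in S, ~~ U w & adj u w].
Proof.
move=> lt_Nn Uf xS Ux.
suff /subsetPn [y yS yU] : ~~ (S \subset f @: setT).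
  apply: (numbering_cut gP xS Ux yS).
  by apply: contra yU => /Uf [l ->]; apply: imset_f; rewrite inE.
apply: contraL lt_Nn => /subset_leq_card; rewrite cardS -leqNgt => le.
by rewrite (leq_trans le) // (leq_trans (leq_imset_card _ _)) // cardsT card_ord.
Qed.

Lemma neighbour x : x \in S -> exists2 y, y \in S & adj x y.
Proof.
move=> xS; have [] := @cut_small 1 (fun=> x) (pred1 x) x _ _ xS (eqxx x) => //.
  by move=> v /eqP ->; exists ord0.
by move=> u [w [_ /eqP -> wS _ a]]; exists w.
Qed.

(** The part of P from [p_l] outwards has at most [n - 1] vertices, and for [l > 0] the only edge
    leaving it goes to the predecessor of [p_l]. *)
Lemma P_segment : exists2 i, i <= m.+3 &
  forall l, (uP l \in S) = (l < i).
Proof.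
apply: (initial_segment (p := fun l => uP l \in S)) => l l' l'l lS.
pose U (v : G) := if v is inr (inl x) then l <= x else false.
have [] := @cut_small m.+3 (@vP _ _ _ _ _) U _ (leqnn _) _ lS (leqnn _).
  by case=> [[a|b]|[x|x]] //; exists x.
move=> [[a|b]|[x|x]] [[[a'|b']|[y|y]] []] //=.
  by move=> _ lx _ _ /eqP x0; lia.
move=> _ lx yS ly xy; suff -> : l' = y by [].
by apply/val_inj => /=; lia.
Qed.

Lemma Q_segment : exists2 j, j <= m.+2 &
  forall l, (uQ l \in S) = (l < j).
Proof.
apply: (initial_segment (p := fun l => uQ l \in S)) => l l' l'l lS.
pose U (v : G) := if v is inr (inr x) then l <= x else false.
have [] := @cut_small m.+2 (@vQ _ _ _ _ _) U _ (leqnSn _) _ lS (leqnn _).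
  by case=> [[a|b]|[x|x]] //; exists x.
move=> [[a|b]|[x|x]] [[[a'|b']|[y|y]] []] //=.
  by move=> _ lx _ _ /eqP x0; lia.
move=> _ lx yS ly xy; suff -> : l' = y by [].
by apply/val_inj => /=; lia.
Qed.

Lemma P_meets_A l : uP l \in S -> exists a, a \in A.
Proof.
pose U (v : G) := if v is inr (inl x) then true else false.
move=> lS; have [] := @cut_small m.+3 (@vP _ _ _ _ _) U _ (leqnn _) _ lS isT.
  by case=> [[a|b]|[x|x]] //; exists x.
move=> [[a|b]|[x|x]] [[[a'|b']|[y|y]] []] //= _ _ aS _ _.
by exists a'; rewrite inE.
Qed.

Lemma Q_meets_B l : uQ l \in S -> exists b, b \in B.
Proof.
pose U (v : G) := if v is inr (inr x) then true else false.
move=> lS; have [] := @cut_small m.+2 (@vQ _ _ _ _ _) U _ (leqnSn _) _ lS isT.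
  by case=> [[a|b]|[x|x]] //; exists x.
move=> [[a|b]|[x|x]] [[[a'|b']|[y|y]] []] //= _ _ aS _ _.
by exists b'; rewrite inE.
Qed.

(** The only edges from the union of A and P to the union of B and Q are those of the half graph. *)
Lemma A_meets_B a b : a \in A -> b \in B -> exists a' b', [/\ a' \in A, b' \in B & b' < a'].
Proof.
rewrite !inE => aS bS.
pose U (v : G) := match v with inl (inl _) | inr (inl _) => true | _ => false end.
have [] := @numbering_cut _ _ _ _ U _ _ gP aS isT bS isT.
move=> [[a'|b']|[x|x]] [[[a''|b'']|[y|y]] []] //= aS' _ bS' _ ab.
by exists a', b''; rewrite !inE.
Qed.

Let p0 : G := uP ord0.
Let q0 : G := uQ ord0.
Let q1 : G := uQ (lift ord0 ord0).

Lemma card_A : #|A| <= 2.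
Proof.
rewrite leqNgt; apply/negP => /card_gt2P [x [y [z [[xA yA zA] [xy yz zx]]]]].
move: xA yA zA; rewrite !inE => xA yA zA.
by apply: (numbering_no_triangle gP xA yA zA) => //=; rewrite val_eqE // eq_sym.
Qed.

Lemma B_neighbour b : m = 0 -> q0 \notin S -> b \in B -> exists2 a : 'I_K.+1, a \in A & b < a.
Proof.
move=> m0 q0S; rewrite inE => /neighbour [[[a|b']|[l|l]]] //= lS.
- by move=> ab; exists a; rewrite ?inE.
- by rewrite m0.
- move/eqP => l0; move: q0S; rewrite (_ : q0 = inr (inr l)) ?lS //.
  by congr (inr (inr _)); apply/val_inj.
Qed.

(** The order of the path determines [i + j] from the sizes of [A] and [B], each at most 2.
    Forbidden triangles, squares and vertices of degree three then leave only the listed sets. *)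
Lemma numbering_copy : exists2 c, valid c & S = copy c.
Proof.
have [i le_i iP] := P_segment.
have [j le_j jP] := Q_segment.
have card_sum : #|A| + #|B| + (i + j) = m.+4.
  rewrite -[RHS]cardS card_graph_set; congr (_ + (_ + _)).
    by rewrite -(card_ltn_ord le_i); apply: eq_card => l; rewrite !inE iP.
  by rewrite -(card_ltn_ord le_j); apply: eq_card => l; rewrite !inE jP.
have p0E : (p0 \in S) = (0 < i) by rewrite iP.
have q0E : (q0 \in S) = (0 < j) by rewrite jP.
have q1E : (q1 \in S) = (1 < j) by rewrite jP.
have inA a : a \in A -> uA a \in S by rewrite inE.
have inB b : b \in B -> uB b \in S by rewrite inE.
have cA := card_A.
have cB : #|B| <= 2.
  rewrite leqNgt; apply/negP => gt2.
  case/card_gt2P: (gt2) => x [y [z [[xB yB zB] [xy yz zx]]]].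
  have xz : x != z by rewrite eq_sym.
  have xS := inB x xB; have yS := inB y yB; have zS := inB z zB.
  have [m0|m0] := eqVneq m 0; last first.
    by apply: (numbering_no_triangle gP xS yS zS); rewrite /= m0.
  (* For [m = 0], three vertices of B would all be adjacent to [q_0], or else, by counting, to the
     single vertex of [A]. *)
  case: (posnP j) => [j0|j_gt0]; last first.
    by rewrite -q0E in j_gt0; apply: (numbering_deg2 gP j_gt0 xS yS zS).
  have q0S : q0 \notin S by rewrite q0E j0.
  have [ax axA axx] := B_neighbour m0 q0S xB.
  have [ay ayA ayy] := B_neighbour m0 q0S yB.
  have [az azA azz] := B_neighbour m0 q0S zB.
  have A_gt0 : 0 < #|A| by apply/card_gt0P; exists ax.
  have /eqP/cards1P [a EA] : #|A| = 1.
    by move: A_gt0 gt2 card_sum; rewrite m0 j0; clear; lia.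
  have aA : a \in A by rewrite EA !inE.
  move: axA ayA azA; rewrite EA !inE => /eqP axE /eqP ayE /eqP azE.
  apply: (numbering_deg2 gP (inA a aA) xS yS zS) => //=.
  - by rewrite -axE.
  - by rewrite -ayE.
  - by rewrite -azE.
(* Without A the set consists of two vertices of B and all of Q, and [q_0] has the three neighbours
   [x], [y], [q_1]. *)
have A_gt0 : #|A| != 0.
  apply/eqP => A0; have i0 : i = 0.
    apply/eqP; rewrite -leqn0 leqNgt -p0E; apply/negP => /P_meets_A [a].
    by rewrite (cards0_eq A0) inE.
  have cB2 : #|B| = 2 by move: card_sum cB le_j; rewrite A0 i0; clear; lia.
  move/eqP: (cB2) => /cards2P [x [y [xy EB]]].
  have xS : _ := inB x _; have {}xS := xS ltac:(by rewrite EB !inE eqxx).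
  have yS : _ := inB y _; have {}yS := yS ltac:(by rewrite EB !inE eqxx orbT).
  have jE : j = m.+2 by move: card_sum; rewrite A0 i0 cB2; clear; lia.
  have q0S : q0 \in S by rewrite q0E jE.
  have q1S : q1 \in S by rewrite q1E jE.
  by apply: (numbering_deg2 gP q0S xS yS q1S).
have memA a : (inl (inl a) : G) \in S = (a \in A) by rewrite inE.
have memB b : (inl (inr b) : G) \in S = (b \in B) by rewrite inE.
(* Without B, two vertices of A would form a triangle with [p_0]; one vertex of A forces all of
   P. *)
have [B0|B_gt0] := eqVneq #|B| 0.
  have j0 : j = 0.
    apply/eqP; rewrite -leqn0 leqNgt -q0E; apply/negP => /Q_meets_B [a].
    by rewrite (cards0_eq B0) inE.
  have [/eqP/cards1P [a EA]|cA2] : #|A| = 1 \/ #|A| = 2.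
  - by move: cA A_gt0; clear; lia.
  - have iE : i = m.+3 by move: card_sum; rewrite EA cards1 B0 j0; clear; lia.
    exists (inr (inr a)) => //; apply/setP => [[[x|x]|[x|x]]]; rewrite ?inE /=.
    + by rewrite memA EA inE.
    + by rewrite memB (cards0_eq B0) inE.
    + by rewrite iP iE.
    + by rewrite jP j0.
  have iE : i = m.+2 by move: card_sum; rewrite cA2 B0 j0; clear; lia.
  move/eqP: (cA2) => /cards2P [x [y [xy EA]]].
  have xS : _ := inA x _; have {}xS := xS ltac:(by rewrite EA !inE eqxx).
  have yS : _ := inA y _; have {}yS := yS ltac:(by rewrite EA !inE eqxx orbT).
  have p0S : p0 \in S by rewrite p0E iE.
  by case: (numbering_no_triangle gP xS yS p0S).
have [a0 [b0 [a0A b0B lt_ba]]] : exists a b, [/\ a \in A, b \in B & b < a].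
  move: A_gt0 B_gt0; rewrite -!lt0n => /card_gt0P [a aA] /card_gt0P [b bB].
  exact: A_meets_B aA bB.
have split2 N (X : {set 'I_N}) x : x \in X -> #|X| <= 2 -> X = [set x] \/
    exists2 y, y != x & X = [set x; y].
  move=> xX; rewrite (cardsD1 x) xX => le1.
  have [/cards0_eq E|X1] := eqVneq #|X :\ x| 0; [left|right].
    by rewrite -(setD1K xX) E setU0.
  have /cards1P [y Ey] : #|X :\ x| == 1 by move: X1 le1; clear; lia.
  exists y; last by rewrite -(setD1K xX) Ey.
  by have : y \in X :\ x by [rewrite Ey inE]; rewrite !inE => /andP [].
have a0S := inA a0 a0A; have b0S := inB b0 b0B.
have [EA|[a1 a1a0 EA]] := split2 _ A a0 a0A cA;
have [EB|[b1 b1b0 EB]] := split2 _ B b0 b0B cB.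
- have ijE : i + j = m.+2 by move: card_sum; rewrite EA EB !cards1; clear; lia.
  have lt_i : i < m.+3 by move: ijE; clear; lia.
  exists (inl (inl (Ordinal lt_i, a0, b0))) => //.
  apply/setP => [[[x|x]|[x|x]]]; rewrite ?inE /=.
  + by rewrite memA EA inE.
  + by rewrite memB EB inE.
  + by rewrite iP.
  + by rewrite jP; congr (_ < _); rewrite -ijE addKn.
- have ijE : i + j = m.+1.
    by move: card_sum; rewrite EA EB cards1 cards2 eq_sym b1b0; clear; lia.
  have b1S : _ := inB b1 _; have {}b1S := b1S ltac:(by rewrite EB !inE eqxx orbT).
  have b0b1 : b0 != b1 by rewrite eq_sym.
  have j0 : m != 0 -> j = 0.
    move=> m0; apply/eqP; rewrite -leqn0 leqNgt -q0E; apply/negP => q0S.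
    by apply: (numbering_no_triangle gP b0S b1S q0S); rewrite /= ?m0.
  (* An edge [a0 b1] closes a triangle if B is a clique. For [m = 0] it closes the square
     [a0 b0 q0 b1], or [p0] is a third neighbour of [a0]. *)
  have le_ab : a0 <= b1.
    rewrite leqNgt; apply/negP => lt_b1a.
    have [m0|m0] := eqVneq m 0; last first.
      by apply: (numbering_no_triangle gP a0S b0S b1S); rewrite /= ?m0.
    case: (posnP i) => [i0|i_gt0].
      have q0S : q0 \in S by rewrite q0E; move: ijE; rewrite i0 m0; clear; lia.
      by apply: (numbering_no_square gP a0S b0S q0S b1S).
    rewrite -p0E in i_gt0.
    by apply: (numbering_deg2 gP a0S b0S b1S i_gt0).
  (* If [i] were positive, then [j = 0] by counting, and [b1] would have no neighbour in [S]. *)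
  have i0 : m = 0 -> i = 0.
    move=> m0; apply/eqP; rewrite -leqn0 leqNgt; apply/negP => i_gt0.
    have q0S : q0 \notin S.
      by rewrite q0E -leqNgt; move: ijE i_gt0; rewrite m0; clear; lia.
    have b1B : b1 \in B by rewrite EB !inE eqxx orbT.
    have [a] := B_neighbour m0 q0S b1B.
    by rewrite EA inE => /eqP ->; rewrite ltnNge le_ab.
  exists (inl (inr (a0, b0, b1))); first by rewrite /= lt_ba le_ab.
  apply/setP => [[[x|x]|[x|x]]]; rewrite ?inE /=.
  + by rewrite memA EA inE.
  + by rewrite memB EB !inE.
  + rewrite iP; congr (_ < _); case: eqP => [/i0 //|/eqP /j0 j0E].
    by rewrite -ijE j0E addn0.
  + rewrite jP; congr (_ < _); case: eqP => [m0|/eqP /j0 //].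
    by move: ijE; rewrite m0 i0.
- have ijE : i + j = m.+1.
    by move: card_sum; rewrite EA EB cards1 cards2 eq_sym a1a0; clear; lia.
  have a1S : _ := inA a1 _; have {}a1S := a1S ltac:(by rewrite EA !inE eqxx orbT).
  have a0a1 : a0 != a1 by rewrite eq_sym.
  have i0 : i = 0.
    apply/eqP; rewrite -leqn0 leqNgt -p0E; apply/negP => p0S.
    by apply: (numbering_no_triangle gP a0S a1S p0S).
  have le_ab : a1 <= b0.
    rewrite leqNgt; apply/negP => lt_b1a.
    by apply: (numbering_no_triangle gP a0S b0S a1S).
  exists (inr (inl (a0, a1, b0))); first by rewrite /= lt_ba le_ab.
  apply/setP => [[[x|x]|[x|x]]]; rewrite ?inE /=.
  + by rewrite memA EA !inE.
  + by rewrite memB EB !inE.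
  + by rewrite iP i0.
  + by rewrite jP; congr (_ < _); rewrite -ijE i0.
(* If B is a clique, [b0], [b1], [q0] form a triangle. For [m = 0] only these four vertices remain:
   either [a0] has degree three, or [b1 < a1] contradicts [a1 <= b0 < a0 <= b1]. *)
- exfalso.
  have ijE : i + j = m.
    move: card_sum; rewrite EA EB !cards2 eq_sym a1a0 eq_sym b1b0; clear; lia.
  have a1S : _ := inA a1 _; have {}a1S := a1S ltac:(by rewrite EA !inE eqxx orbT).
  have b1B : b1 \in B by rewrite EB !inE eqxx orbT.
  have b1S := inB b1 b1B.
  have a0a1 : a0 != a1 by rewrite eq_sym.
  have b0b1 : b0 != b1 by rewrite eq_sym.
  have i0 : i = 0.
    apply/eqP; rewrite -leqn0 leqNgt -p0E; apply/negP => p0S.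
    by apply: (numbering_no_triangle gP a0S a1S p0S).
  have [m0|m0] := eqVneq m 0; last first.
    have q0S : q0 \in S by rewrite q0E; move: ijE m0; rewrite i0; clear; lia.
    by apply: (numbering_no_triangle gP b0S b1S q0S); rewrite /= ?m0.
  have q0S : q0 \notin S by rewrite q0E; move: ijE; rewrite i0 m0; clear; lia.
  have le_ab : a1 <= b0.
    rewrite leqNgt; apply/negP => lt_b1a.
    by apply: (numbering_no_triangle gP a0S b0S a1S).
  have [a] := B_neighbour m0 q0S b1B.
  rewrite EA !inE => /orP [] /eqP -> lt_b1.
    by apply: (numbering_deg2 gP a0S b0S b1S a1S) => //.
  have le_ab1 : a0 <= b1.
    rewrite leqNgt; apply/negP => lt_b1a.
    by apply: (numbering_no_triangle gP a0S b1S a1S).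
  by move: lt_ba le_ab lt_b1 le_ab1; clear; lia.
Qed.

End Classification.

(** * Degrees for [n >= 4] *)

Lemma sum_delta (I : finType) (k : I) (F : I -> nat) :
  (forall x, x != k -> F x = 0) -> \sum_x F x = F k.
Proof. by move=> F0; rewrite (bigD1 k) //= big1 ?addn0. Qed.

Lemma sum_prod (I J : finType) (F : I * J -> nat) :
  \sum_p F p = \sum_i \sum_j F (i, j).
Proof. by rewrite pair_bigA; apply: eq_bigr => [[]]. Qed.

Lemma sum_lt N k : k <= N -> \sum_(x < N) (x < k) = k.
Proof. by move=> le; rewrite -big_mkcond (sum_ltn_ord (fun=> 1) le) sum1_card card_ord. Qed.

Lemma sum_ge N k : \sum_(x < N) (k <= x) = N - k.
Proof.
rewrite (reindex_inj rev_ord_inj) /= -[RHS](@sum_lt N) ?leq_subr //.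
by apply: eq_bigr => x _; have := ltn_ord x; lia.
Qed.

Lemma triangular k : (\sum_(x < k) x.+1).*2 = k * k.+1.
Proof. by elim: k => [|k IH]; [rewrite big_ord0 | rewrite big_ord_recr /= doubleD IH; lia]. Qed.

Lemma sum_rev N : \sum_(x < N) (N - x) = \sum_(x < N) x.+1.
Proof.
rewrite (reindex_inj rev_ord_inj) /=.
by apply: eq_bigr => x _; have := ltn_ord x; lia.
Qed.

Lemma sum_lt_mul N k (F : nat -> nat) :
  k <= N -> \sum_(x < N) (x < k) * F x = \sum_(x < k) F x.
Proof.
move=> le; rewrite -(sum_ltn_ord _ le) [RHS]big_mkcond.
by apply: eq_bigr => x _; case: (x < k); rewrite ?mul1n.
Qed.

Lemma sum_ge_mul N k : k <= N ->
  \sum_(x < N) (k <= x) * (N - x) = \sum_(x < N - k) x.+1.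
Proof.
move=> le; rewrite (reindex_inj rev_ord_inj) /=.
rewrite -(@sum_lt_mul N (N - k) succn) ?leq_subr //.
by apply: eq_bigr => x _; have := ltn_ord x; lia.
Qed.

Lemma triangular0 k : (\sum_(x < k) x).*2 + k = k * k.
Proof.
elim: k => [|k IH]; first by rewrite big_ord0.
by rewrite big_ord_recr /= doubleD -[k.*2]addnn -!addnA [LHS]addnA IH; lia.
Qed.

Section Degrees.
Variables (m K : nat).
Let n := m.+4.
Let G := graph true (m != 0) K m.+3 m.+2.
Local Notation uA := (vA true (m != 0) m.+3 m.+2).
Local Notation uB := (vB true (m != 0) m.+3 m.+2).
Local Notation uP := (vP true (m != 0) K m.+2).
Local Notation uQ := (vQ true (m != 0) K m.+3).

(** The traces on A and B give everything except the length [i] of an edge case, which is recovered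
    by testing [p_i1] and [p_i2]. *)
Lemma copy_inj : {in [pred c : copy_index m K | valid c] &, injective (@copy m K)}.
Proof.
move=> c c'; rewrite !inE => vc vc' /setP E.
have EA x := E (uA x).
have EB x := E (uB x).
have EP x := E (uP x).
clear E.
case: c EA EB EP vc => [[[[i1 a1] b1]|[[a1 b1] b1']]|[[[a1 a1'] b1]|a1]] EA EB EP /= vc;
case: c' EA EB EP vc' => [[[[i2 a2] b2]|[[a2 b2] b2']]|[[[a2 a2'] b2]|a2]] EA EB EP /= vc'.
all: have := EA a1; have := EA a2; try have := EA a1'; try have := EA a2'.
all: try have := EB b1; try have := EB b2; try have := EB b1'; try have := EB b2'.
all: try have := EP i1; try have := EP i2; clear EA EB EP.
all: rewrite !inE /=; try (move: vc vc'; clear; lia).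
- move=> *; congr (inl (inl (_, _, _))); apply/val_inj => /=; lia.
- move=> *; congr (inl (inr (_, _, _))); apply/val_inj => /=; lia.
- move=> *; congr (inr (inl (_, _, _))); apply/val_inj => /=; lia.
- move=> *; congr (inr (inr _)); apply/val_inj => /=; lia.
Qed.

(** By the classification, [copy] is a bijection from valid indices to induced paths. *)
Lemma sub_degreeE (v : G) :
  sub_degree (path_graph n) v = \sum_(c : copy_index m K) (valid c && (v \in copy c)).
Proof.
pose C := [set c : copy_index m K | valid c && (v \in copy c)].
transitivity #|[set copy c | c in C]|.
  apply: eq_card => S; rewrite inE; apply/andP/imsetP.
    move=> [vS /isomorphicP/isomorphic_numbering [g /numbering_copy [c vc Sc]]].
    by exists c => //; rewrite inE vc -Sc.
  move=> [c]; rewrite inE => /andP [vc vcopy] ->; split=> //.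
  apply/isomorphicP/isomorphic_numbering.
  by exists (copy_pos c); apply: copy_numbering.
rewrite card_in_imset; last first.
  by move=> c c'; rewrite !inE => /andP [vc _] /andP [vc' _]; apply: copy_inj.
by rewrite -sum1dep_card big_mkcond; apply: eq_bigr => c _; case: (_ && _).
Qed.

Lemma sum_copy_index (F : copy_index m K -> nat) :
  \sum_c F c =
    \sum_(i < m.+3) \sum_(a < K.+1) \sum_(b < K) F (inl (inl (i, a, b)))
  + \sum_(a < K.+1) \sum_(b < K) \sum_(b' < K) F (inl (inr (a, b, b')))
  + (\sum_(a < K.+1) \sum_(a' < K.+1) \sum_(b < K) F (inr (inl (a, a', b)))
  + \sum_(a < K.+1) F (inr (inr a))).
Proof. by rewrite !big_sumType /= !sum_prod. Qed.

Definition edges := \sum_(x < K) x.+1.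
(** Counts the traces [a b b']: [a] has [a] neighbours and [K - a] non-neighbours in B. *)
Definition wedges := \sum_(a < K.+1) a * (K - a).

Lemma sum_edges : \sum_(a < K.+1) \sum_(b < K) (b < a) = edges.
Proof.
rewrite exchange_big /edges -sum_rev; apply: eq_bigr => b _.
exact: (sum_ge K.+1 b.+1).
Qed.

Lemma sum_wedges_B : \sum_(a < K.+1) \sum_(b < K) \sum_(b' < K) (b < a <= b') = wedges.
Proof.
apply: eq_bigr => a _; rewrite -[X in _ = X * _](sum_lt (leq_ord a)) big_distrl /=.
apply: eq_bigr => b _; rewrite -sum_ge big_distrr /=.
by apply: eq_bigr => b' _; rewrite mulnb.
Qed.

(** The vertex [b] has [K - b] neighbours and [b.+1] non-neighbours in A, and [b.+1 * (K - b)]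
    splits as [b * (K - b) + (K - b)]. *)
Lemma sum_wedges_A :
  \sum_(a < K.+1) \sum_(a' < K.+1) \sum_(b < K) (a' <= b < a) = wedges + edges.
Proof.
transitivity (\sum_(b < K) b.+1 * (K - b)).
  under eq_bigr => a _ do rewrite exchange_big.
  rewrite exchange_big /=; apply: eq_bigr => b _.
  rewrite -[K - b](sum_ge K.+1 b.+1) big_distrr /=; apply: eq_bigr => a _.
  rewrite -[X in _ = X * _](sum_lt (leqW (ltn_ord b))) big_distrl /=.
  by apply: eq_bigr => a' _; rewrite mulnb.
rewrite /wedges big_ord_recr /= subnn muln0 addn0 /edges -sum_rev -big_split /=.
by apply: eq_bigr => b _; rewrite mulSn addnC.
Qed.

Lemma degree_A (k : 'I_K.+1) :
  sub_degree (path_graph n) (uA k : G) = 1 + m.+3 * k + edges.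
Proof.
have le_kK : k <= K by rewrite -ltnS.
rewrite sub_degreeE sum_copy_index.
(* The terms count edge traces, traces [a b b'], traces [a' a b] with [a_k] as [a] and then as [a'],
   and the path through all of P. With T the triangular numbers,
   [T(k) + T(K - k) + k (K - k) = T(K)]. *)
transitivity (m.+3 * k + k * (K - k)
  + (\sum_(b < K) (b < k) * b.+1 + \sum_(b < K) (k <= b) * (K - b) + 1)); last first.
  rewrite (sum_lt_mul succn le_kK) (sum_ge_mul le_kK) /edges.
  have := triangular k; have := triangular (K - k); have := triangular K.
  move: (\sum_(x < k) _) (\sum_(x < K - k) _) (\sum_(x < K) _) => x y z.
  by clear n G; nia.
congr (_ + _ + (_ + _)).
- rewrite -[m.+3 in RHS]card_ord -sum_nat_const; apply: eq_bigr => i _.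
  rewrite (@sum_delta _ k) => [|a ak].
    by rewrite -[RHS](sum_lt le_kK); apply: eq_bigr => b _; rewrite inE /= eqxx andbT.
  by apply: big1 => b _; rewrite inE /= val_eqE eq_sym (negbTE ak) andbF.
- rewrite (@sum_delta _ k) => [|a ak].
    rewrite -{1}(sum_lt le_kK) big_distrl /=; apply: eq_bigr => b _.
    rewrite -sum_ge big_distrr /=; apply: eq_bigr => b' _.
    by rewrite inE /= eqxx andbT mulnb.
  by apply: big1 => b _; apply: big1 => b' _; rewrite inE /= val_eqE eq_sym (negbTE ak) andbF.
- transitivity (\sum_(a < K.+1) \sum_(a' < K.+1) \sum_(b < K)
     ((a == k) * (a' <= b < k) + (a' == k) * (k <= b < a))).
    apply: eq_bigr => a _; apply: eq_bigr => a' _; apply: eq_bigr => b _.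
    by rewrite inE /= -!val_eqE /=; clear; lia.
  under eq_bigr => a _ do under eq_bigr => a' _ do rewrite big_split /=.
  under eq_bigr => a _ do rewrite big_split /=.
  rewrite big_split /=; congr (_ + _).
    rewrite (@sum_delta _ k) => [|a ak]; last first.
      by apply: big1 => a' _; apply: big1 => b _; rewrite (negbTE ak).
    rewrite exchange_big /=; apply: eq_bigr => b _.
    rewrite -[X in _ * X](sum_lt (leqW (ltn_ord b))) big_distrr /=.
    by apply: eq_bigr => a' _; rewrite eqxx mul1n andbC mulnb.
  transitivity (\sum_(a < K.+1) \sum_(b < K) (k <= b < a)).
    apply: eq_bigr => a _; rewrite (@sum_delta _ k) => [|a' ak].
      by apply: eq_bigr => b _; rewrite eqxx mul1n.
    by apply: big1 => b _; rewrite (negbTE ak).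
  rewrite exchange_big /=; apply: eq_bigr => b _.
  rewrite -[K - b](sum_ge K.+1 b.+1) big_distrr /=.
  by apply: eq_bigr => a _; rewrite mulnb.
- rewrite (@sum_delta _ k) => [|a ak]; first by rewrite inE /= eqxx.
  by rewrite inE /= val_eqE eq_sym (negbTE ak).
Qed.

Lemma degree_B (k : 'I_K) :
  sub_degree (path_graph n) (uB k : G) = m.+3 * (K - k) + edges.
Proof.
have lt_kK := ltn_ord k.
rewrite sub_degreeE sum_copy_index.
(* The bracket counts traces [a b b'] with [b_k] as [b] and then as [b']; the next term counts
   traces [a' a b]. Together they give the binomial coefficient of [K + 1] over 2, which is
   [edges]. *)
transitivity (m.+3 * (K - k)
  + (\sum_(a < K.+1) (k < a) * (K - a) + \sum_(a < K.+1) (a < k.+1) * a)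
  + (k.+1 * (K - k) + 0)); last first.
  rewrite (sum_lt_mul id (leqW lt_kK)) /=.
  have -> : \sum_(a < K.+1) (k < a) * (K - a) = \sum_(a < K - k) a.
    rewrite (reindex_inj rev_ord_inj) /= -(@sum_lt_mul K.+1 _ id) ?leqW ?leq_subr //.
    by apply: eq_bigr => a _; have := leq_ord a; clear -lt_kK; lia.
  have := triangular0 k.+1; have := triangular0 (K - k); have := triangular K.
  rewrite /edges; move: (\sum_(x < k.+1) _) (\sum_(x < K - k) _) (\sum_(x < K) _) => x y z.
  by move: lt_kK; clear n G; nia.
congr (_ + _ + (_ + _)).
- rewrite -[m.+3 in RHS]card_ord -sum_nat_const; apply: eq_bigr => i _.
  rewrite exchange_big (@sum_delta _ k) => [|b bk].
    rewrite -[RHS](sum_ge K.+1 k.+1); apply: eq_bigr => a _.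
    by rewrite inE /= eqxx andbT.
  by apply: big1 => a _; rewrite inE /= val_eqE eq_sym (negbTE bk) andbF.
- rewrite -big_split /=; apply: eq_bigr => a _.
  transitivity (\sum_(b < K) \sum_(b' < K)
     ((b == k) * (k < a <= b') + (b' == k) * (b < a <= k))).
    apply: eq_bigr => b _; apply: eq_bigr => b' _.
    by rewrite inE /= -!val_eqE /=; clear; lia.
  under eq_bigr => b _ do rewrite big_split /=.
  rewrite big_split /=; congr (_ + _).
    rewrite (@sum_delta _ k) => [|b bk]; last first.
      by apply: big1 => b' _; rewrite (negbTE bk).
    rewrite -sum_ge big_distrr /=.
    by apply: eq_bigr => b' _; rewrite eqxx mul1n mulnb.
  rewrite exchange_big (@sum_delta _ k) => [|b bk]; last first.
    by apply: big1 => b' _; rewrite (negbTE bk).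
  rewrite -[X in _ * X](sum_lt (leq_ord a)) big_distrr /=.
  by apply: eq_bigr => b _; rewrite eqxx mul1n mulnb andbC.
- transitivity (\sum_(a < K.+1) \sum_(a' < K.+1) (a' < k.+1) * (k < a)).
    apply: eq_bigr => a _; apply: eq_bigr => a' _.
    rewrite (@sum_delta _ k) => [|b bk]; first by rewrite inE /= eqxx andbT mulnb.
    by rewrite inE /= val_eqE eq_sym (negbTE bk) andbF.
  rewrite -[K - k](sum_ge K.+1 k.+1) big_distrr /=; apply: eq_bigr => a _.
  by rewrite -big_distrl /= sum_lt // leqW.
- by apply: big1 => a _; rewrite inE.
Qed.

(** An edge trace reaches [p_l] for the [m.+2 - l] values [i > l], traces [a' a b] never do, and
    each of the [K.+1] single-vertex traces uses all of P. *)
Lemma degree_P (l : 'I_m.+3) :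
  sub_degree (path_graph n) (uP l : G) =
    (m.+2 - l) * edges + (l < if m == 0 then 0 else m.+1) * wedges + K.+1.
Proof.
rewrite sub_degreeE sum_copy_index.
transitivity ((m.+2 - l) * edges + (l < if m == 0 then 0 else m.+1) * wedges + (0 + K.+1));
  last by [].
congr (_ + _ + (_ + _)).
- rewrite -[m.+2 - l](sum_ge m.+3 l.+1) big_distrl /=; apply: eq_bigr => i _.
  rewrite -sum_edges big_distrr /=; apply: eq_bigr => a _.
  rewrite big_distrr /=; apply: eq_bigr => b _.
  by rewrite inE /= andbC mulnb.
- rewrite -sum_wedges_B big_distrr /=; apply: eq_bigr => a _.
  rewrite big_distrr /=; apply: eq_bigr => b _.
  rewrite big_distrr /=; apply: eq_bigr => b' _.
  by rewrite inE /= andbC mulnb.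
- by apply: big1 => a _; apply: big1 => a' _; apply: big1 => b _; rewrite inE andbF.
- rewrite -[RHS]card_ord -sum1_card; apply: eq_bigr => a _.
  by rewrite inE /= ltn_ord.
Qed.

Lemma degree_Q (l : 'I_m.+2) :
  sub_degree (path_graph n) (uQ l : G) =
    (m.+2 - l) * edges + (l < (m == 0)) * wedges + (l < m.+1) * (wedges + edges).
Proof.
rewrite sub_degreeE sum_copy_index.
transitivity ((m.+2 - l) * edges + (l < (m == 0)) * wedges
  + ((l < m.+1) * (wedges + edges) + 0)); last by rewrite addn0.
have lt_l := ltn_ord l.
congr (_ + _ + (_ + _)).
- rewrite -[m.+2 - l](@sum_lt m.+3) ?(leq_trans (leq_subr _ _)) // big_distrl /=.
  apply: eq_bigr => i _.
  rewrite -sum_edges big_distrr /=; apply: eq_bigr => a _.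
  rewrite big_distrr /=; apply: eq_bigr => b _.
  by rewrite inE /= mulnb andbC !ltn_subRL addnC.
- rewrite -sum_wedges_B big_distrr /=; apply: eq_bigr => a _.
  rewrite big_distrr /=; apply: eq_bigr => b _.
  rewrite big_distrr /=; apply: eq_bigr => b' _.
  by rewrite inE /= andbC mulnb.
- rewrite -sum_wedges_A big_distrr /=; apply: eq_bigr => a _.
  rewrite big_distrr /=; apply: eq_bigr => a' _.
  rewrite big_distrr /=; apply: eq_bigr => b _.
  by rewrite inE /= andbC mulnb.
- by apply: big1 => a _; rewrite inE.
Qed.

End Degrees.

Lemma mulnD_inj e x y r s : r < e -> s < e -> x * e + r = y * e + s -> x = y /\ r = s.
Proof.
move=> re se E; have e_gt0 : 0 < e by lia.
split.
  by have /(congr1 (divn^~ e)) := E; rewrite !divnMDl // !divn_small // !addn0.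
by have /(congr1 (modn^~ e)) := E; rewrite !modnMDl !modn_small.
Qed.

(** * Distinctness of the degrees for [n >= 4] *)

Section Irregular.
Variables (m M K : nat).
Hypotheses (M_ge3 : 3 <= M) (KE : K = 1 + m.+3 * M).
Let n := m.+4.
Let G := graph true (m != 0) K m.+3 m.+2.
Local Notation uA := (vA true (m != 0) m.+3 m.+2).
Local Notation uB := (vB true (m != 0) m.+3 m.+2).
Local Notation uP := (vP true (m != 0) K m.+2).
Local Notation uQ := (vQ true (m != 0) K m.+3).
Local Notation e := (edges K).
Local Notation w := (wedges K).

(** [e] is quadratic in [K], and [3 <= M] makes [K] large enough. All degrees on A and B then lie
    between [e] and [2 e]. *)
Lemma edges_large : m.+3 * K + 1 < e.
Proof.
have := triangular K; rewrite -/(edges K).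
have : m.*2 + 8 <= K by rewrite KE; move: M_ge3; clear; nia.
by move: e; clear; nia.
Qed.

Lemma low_remainder r q y : r < e -> e + r = q * e + y -> q < 2.
Proof. by move=> re E; rewrite ltnNge; apply/negP => q2; move: (e) re E q2; clear; nia. Qed.

(** [dP] and [dQ] indicate whether the traces [a b b'] extend to the given vertex of P or Q. *)
Let dP l : nat := l < if m == 0 then 0 else m.+1.
Let dQ l : nat := l < (m == 0).

(** After cancelling [e], the residues modulo [m.+3] are 1 and 0. *)
Lemma A_neq_B (a : 'I_K.+1) (b : 'I_K) : 1 + m.+3 * a + e <> m.+3 * (K - b) + e.
Proof.
move/addIn; rewrite addnC -[RHS]addn0 ![m.+3 * _]mulnC.
by case/(@mulnD_inj m.+3).
Qed.

Lemma A_small (a : 'I_K.+1) : 1 + m.+3 * a < e.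
Proof.
apply: leq_ltn_trans edges_large.
by rewrite addnC leq_add2r leq_mul2l leq_ord orbT.
Qed.

Lemma B_small (b : 'I_K) : m.+3 * (K - b) < e.
Proof.
apply: leq_ltn_trans edges_large; apply: leq_trans (leq_addr 1 _).
by rewrite leq_mul2l leq_subr orbT.
Qed.

Lemma K_small : K.+1 < e.
Proof. by apply: leq_ltn_trans edges_large; rewrite addn1 ltnS leq_pmull. Qed.

(** A degree below [2 e] forces [m < l], where no three-vertex trace contributes, so the remainder
    modulo [e] is [K.+1]. *)
Lemma low_P r (l : 'I_m.+3) : r < e ->
  e + r = (m.+2 - l) * e + dP l * w + K.+1 -> r = K.+1.
Proof.
move=> re E; have := E; rewrite -addnA => /(low_remainder re) q2.
have lm : m < l by move: q2; clear; lia.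
have dP0 : dP l = 0 by rewrite /dP; case: eqP => // _; move: lm; clear; lia.
by move: E; rewrite dP0 addn0 -{1}[e]mul1n => /mulnD_inj [] //; apply: K_small.
Qed.

Lemma low_Q r (l : 'I_m.+2) : r < e ->
  e + r = (m.+2 - l) * e + dQ l * w + (l < m.+1) * (w + e) -> r = 0.
Proof.
move=> re E; have := E; rewrite -addnA => /(low_remainder re) q2.
have lm : m < l by move: q2; clear; lia.
have dQ0 : dQ l = 0 by rewrite /dQ; case: (m == 0) lm; clear; lia.
have lm' : (l < m.+1) = false by move: lm; clear; lia.
move: E; rewrite dQ0 lm' !addn0 -{1}[e]mul1n -[RHS]addn0.
by case/mulnD_inj => //; move: re; clear; lia.
Qed.

(** Either the sizes differ, or the terms [w] cancel and the remainders [K.+1] and 0 modulo [e]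
    differ. *)
Lemma P_neq_Q (l : 'I_m.+3) (l' : 'I_m.+2) : (m.+2 - l) * e + dP l * w + K.+1 <>
  (m.+2 - l') * e + dQ l' * w + (l' < m.+1) * (w + e).
Proof.
have Ke := K_small; have e_gt0 : 0 < e by apply: leq_ltn_trans Ke.
have high x y : x * e + K.+1 <> y * e.
  by rewrite -[RHS]addn0 => /mulnD_inj [].
have [l'm|l'm] := ltnP l' m.+1; last first.
  have dQ0 : dQ l' = 0 by rewrite /dQ; case: (m == 0) l'm; clear; lia.
  have l'E : m.+2 - l' = 1 by have := ltn_ord l'; move: l'm; clear; lia.
  rewrite dQ0 l'E !addn0 mul1n => E.
  have q1 : m.+2 - l < 1.
    rewrite ltnNge; apply/negP => q1; move: (e) E q1; clear; nia.
  have lE : m.+2 - l = 0 by move: q1; clear; lia.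
  have dP0 : dP l = 0 by rewrite /dP; case: eqP => // _; move: lE; clear; lia.
  by move: E Ke; rewrite lE dP0; clear; lia.
rewrite mul1n; have [m0|m0] := eqVneq m 0.
  have m0b : (m == 0) = true by apply/eqP.
  have dP0 : dP l = 0 by rewrite /dP m0b.
  have dQ1 : dQ l' = 1 by rewrite /dQ m0b /=; move: l'm m0; clear; lia.
  have le_l : m.+2 - l <= 2 by move: m0; clear; lia.
  have l'E : m.+2 - l' = 2 by move: l'm m0; clear; lia.
  by rewrite dP0 dQ1 l'E; move: (e) (w) (m.+2 - l) le_l Ke; clear; nia.
have dQ0 : dQ l' = 0 by rewrite /dQ (negbTE m0).
have [lm|lm] := ltnP l m.+1.
  have -> : dP l = 1 by rewrite /dP (negbTE m0) lm.
  rewrite dQ0 mul1n addn0 addnAC [w + e]addnC addnA => /addIn.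
  by rewrite [_ * e + e]addnC -mulSn; apply: high.
have q1 : m.+2 - l <= 1 by move: lm; clear; lia.
have q2 : 2 <= m.+2 - l' by move: l'm; clear; lia.
have -> : dP l = 0 by rewrite /dP (negbTE m0) ltnNge lm.
by rewrite dQ0; move: (e) (w) (m.+2 - l) (m.+2 - l') q1 q2 Ke; clear; nia.
Qed.

(** By the choice of [K], [K.+1] has residue 2 modulo [m.+3]. *)
Lemma K_residue x r : r < 2 -> r + m.+3 * x <> K.+1.
Proof.
move=> r2; rewrite KE addnC -[RHS]addn1 addnAC [_ * M]mulnC [m.+3 * x]mulnC addnC => E.
have : x * m.+3 + r = M * m.+3 + 2 by move: E; clear; lia.
by case/mulnD_inj => [||_ rE] //; [apply: leq_trans r2 _ | rewrite rE in r2].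
Qed.

Lemma graph_irregular : irregular (path_graph n) G.
Proof.
have Ke := K_small; have e_gt0 : 0 < e by apply: leq_ltn_trans Ke.
have AP (a : 'I_K.+1) (l : 'I_m.+3) :
    1 + m.+3 * a + e <> (m.+2 - l) * e + dP l * w + K.+1.
  by rewrite addnC => /(low_P (A_small a)); exact: (@K_residue a 1 isT).
have AQ (a : 'I_K.+1) (l : 'I_m.+2) :
    1 + m.+3 * a + e <> (m.+2 - l) * e + dQ l * w + (l < m.+1) * (w + e).
  by rewrite addnC => /(low_Q (A_small a)).
have BP (b : 'I_K) (l : 'I_m.+3) :
    m.+3 * (K - b) + e <> (m.+2 - l) * e + dP l * w + K.+1.
  by rewrite addnC => /(low_P (B_small b)); exact: (@K_residue (K - b) 0 isT).
have BQ (b : 'I_K) (l : 'I_m.+2) :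
    m.+3 * (K - b) + e <> (m.+2 - l) * e + dQ l * w + (l < m.+1) * (w + e).
  rewrite addnC => /(low_Q (B_small b)) /eqP; rewrite muln_eq0 /= subn_eq0.
  by rewrite leqNgt ltn_ord.
have AA (a a' : 'I_K.+1) : 1 + m.+3 * a + e = 1 + m.+3 * a' + e -> a = a'.
  by move/addIn/addnI/eqP; rewrite eqn_pmul2l // => /eqP/val_inj.
have BB (b b' : 'I_K) : m.+3 * (K - b) + e = m.+3 * (K - b') + e -> b = b'.
  move/addIn/eqP; rewrite eqn_pmul2l // => /eqP E; apply/val_inj => /=.
  by have := ltn_ord b; have := ltn_ord b'; move: E; clear; lia.
(* Along P, and likewise along Q, the degree strictly decreases with the distance from the half
   graph. *)
have PP (l l' : 'I_m.+3) : (m.+2 - l) * e + dP l * w + K.+1 =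
    (m.+2 - l') * e + dP l' * w + K.+1 -> l = l'.
  wlog lt_ll : l l' / l < l' => [H|].
    case: (ltngtP l l') => [|lt E|/val_inj //]; first exact: H.
    by apply/esym/H.
  have le_d : dP l' <= dP l by rewrite /dP; case: (_ < _) / ltnP => // ?; rewrite (ltn_trans lt_ll).
  have lt_q : m.+2 - l' < m.+2 - l by have := ltn_ord l'; move: lt_ll; clear; lia.
  by move: (e) (w) (dP l) (dP l') le_d (m.+2 - l) (m.+2 - l') lt_q e_gt0; clear; nia.
have QQ (l l' : 'I_m.+2) : (m.+2 - l) * e + dQ l * w + (l < m.+1) * (w + e) =
    (m.+2 - l') * e + dQ l' * w + (l' < m.+1) * (w + e) -> l = l'.
  wlog lt_ll : l l' / l < l' => [H|].
    case: (ltngtP l l') => [|lt E|/val_inj //]; first exact: H.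
    by apply/esym/H.
  have le_d : dQ l' <= dQ l by rewrite /dQ; case: (_ < _) / ltnP => // ?; rewrite (ltn_trans lt_ll).
  have le_d' : (l' < m.+1) <= (l < m.+1) by case: (_ < _) / ltnP => // ?; rewrite (ltn_trans lt_ll).
  have lt_q : m.+2 - l' < m.+2 - l by have := ltn_ord l'; move: lt_ll; clear; lia.
  move: (nat_of_bool (l < m.+1)) (nat_of_bool (l' < m.+1)) le_d' => c c' le_c.
  by move: (e) (w) (dQ l) (dQ l') le_d (m.+2 - l) (m.+2 - l') lt_q e_gt0; clear -le_c; nia.
suff inj : injective (@sub_degree (path_graph n) G) by move=> u v uv /inj.
have degE := (@degree_A m K, @degree_B m K, @degree_P m K, @degree_Q m K).
move=> [[a|b]|[l|l]] [[a'|b']|[l'|l']].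
all: rewrite -?/(uA _) -?/(uB _).
all: rewrite -?/(uP _) -?/(uQ _).
all: rewrite !degE.
all: try by [move/A_neq_B | move/AP | move/AQ | move/BP | move/BQ | move/P_neq_Q
  | move/esym/A_neq_B | move/esym/AP | move/esym/AQ | move/esym/BP | move/esym/BQ
  | move/esym/P_neq_Q | move/AA -> | move/BB -> | move/PP -> | move/QQ ->].
Qed.

End Irregular.

(** * The case [n = 3] *)

Section TriangleFree.
Variable G : sgraph.
Hypothesis triangle_free : forall x y z : G, adj x y -> adj y z -> adj x z = false.

Definition nbr (v : G) : {set G} := [set w | adj v w].

Lemma adj_neq (x y : G) : adj x y -> x != y.
Proof. by apply: contraTneq => ->; rewrite adj_irrefl. Qed.

Lemma isomorphic_P3 (S : {set G}) :
  isomorphic (path_graph 3) (induced S) <->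
  exists x y z, [/\ adj x y, adj y z, x != z & S = [set x; y; z]].
Proof.
rewrite isomorphic_numbering; split=> [[g gP]|[x [y [z [xy yz xz ->]]]]].
  have [cardS g_lt g_inj g_adj] := gP.
  have [x xS gx] := numbering_surj gP (isT : 0 < 3).
  have [y yS gy] := numbering_surj gP (isT : 1 < 3).
  have [z zS gz] := numbering_surj gP (isT : 2 < 3).
  exists x, y, z; split; rewrite ?g_adj ?gx ?gy ?gz //.
    by apply/eqP => E; move: gz; rewrite -E gx.
  apply/setP => u; rewrite !inE; apply/idP/idP => [uS|]; last first.
    by move=> /orP [/orP [] |] /eqP ->.
  have := g_lt u uS; case E: (g u) => [|[|[|]]] // _.
  - by rewrite (g_inj u x) ?eqxx // E.
  - by rewrite (g_inj u y) ?eqxx ?orbT // E.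
  - by rewrite (g_inj u z) ?eqxx ?orbT // E.
have nxy := adj_neq xy; have nyz := adj_neq yz.
have nyx : y != x by rewrite eq_sym.
have nzx : z != x by rewrite eq_sym.
have nzy : z != y by rewrite eq_sym.
have xz' := triangle_free xy yz.
exists (fun u => if u == x then 0 else if u == y then 1 else 2); split.
- by rewrite setUC cardsU1 cards2 !inE negb_or nzx nzy nxy.
- by move=> u _; do ?case: ifP.
- move=> u u'; rewrite !inE => /orP [/orP []|] /eqP -> /orP [/orP []|] /eqP -> //;
    by rewrite ?eqxx ?(negbTE nyx) ?(negbTE nzx) ?(negbTE nzy).
- move=> u u'; rewrite !inE => /orP [/orP []|] /eqP -> /orP [/orP []|] /eqP ->;
    rewrite ?eqxx ?(negbTE nyx) ?(negbTE nzx) ?(negbTE nzy) ?eqxx //=;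
    rewrite ?adj_irrefl // adj_sym ?xy ?yz ?xz' //.
Qed.

(** [C1] collects the paths with [v] in the middle, [C2] those with [v] at an end. *)
Lemma sub_degree_P3 (v : G) :
  sub_degree (path_graph 3) v = 'C(#|nbr v|, 2) + \sum_(y in nbr v) (#|nbr y|).-1.
Proof.
pose C1 := [set v |: D | D : {set G} in [set D : {set G} | D \subset nbr v & #|D| == 2]].
pose C2 := [set [set v; p.1; p.2] | p : G * G in [set p | (adj v p.1 && adj p.1 p.2) && (p.2 != v)]].
(* Intersecting with [nbr v] recovers the pair [D] in the first kind and the middle vertex in the
   second. This yields disjointness and injectivity. *)
have I1 (D : {set G}) : D \subset nbr v -> nbr v :&: (v |: D) = D.
  move=> /subsetP sD; apply/setP => u; rewrite !inE.
  case uD: (u \in D); first by have := sD u uD; rewrite inE orbT => ->.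
  by rewrite orbF; apply/andP => [[vu /eqP uv]]; rewrite uv adj_irrefl in vu.
have I2 (y z : G) : adj v y -> adj y z -> nbr v :&: [set v; y; z] = [set y].
  move=> vy yz; apply/setP => u; rewrite !inE.
  have [->|uy] := eqVneq u y; first by rewrite vy orbT.
  apply/andP => [[vu]]; rewrite orbF => /orP [] /eqP uE; rewrite uE in vu.
    by rewrite adj_irrefl in vu.
  by rewrite (triangle_free vy yz) in vu.
transitivity #|C1 :|: C2|.
  apply: eq_card => S; rewrite !inE; apply/andP/orP.
    move=> [vS /isomorphicP/isomorphic_P3 [x [y [z [xy yz xz SE]]]]].
    move: vS; rewrite SE !inE => /orP [/orP []|] /eqP vE.
    - right; apply/imsetP; exists (y, z); last by rewrite vE.
      by rewrite inE /= vE xy yz eq_sym.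
    - left; apply/imsetP; exists [set x; z]; last by rewrite vE setUA [y |: _]setUC.
      rewrite inE cards2 xz andbT; apply/subsetP => u; rewrite !inE vE.
      by move=> /orP [] /eqP -> //; rewrite adj_sym.
    - right; apply/imsetP; exists (y, x); last first.
        apply/setP => u; rewrite vE !inE /=.
        by case: (u == x); case: (u == y); case: (u == z).
      by rewrite inE /= vE [adj z y]adj_sym yz adj_sym xy.
  case=> /imsetP [].
    move=> D; rewrite inE => /andP [sD /cards2P [x [z [xz DE]]]] ->.
    split; first by rewrite !inE eqxx.
    move/subsetP: (sD) => sD'; rewrite DE in sD'.
    have := sD' x; rewrite !inE eqxx => /(_ isT) vx.
    have := sD' z; rewrite !inE eqxx orbT => /(_ isT) vz.
    apply/isomorphicP/isomorphic_P3; exists x, v, z; split=> //.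
      by rewrite adj_sym.
    by rewrite DE setUA [v |: _]setUC.
  move=> [y z]; rewrite inE /= => /andP [/andP [vy yz] zv] ->.
  split; first by rewrite !inE eqxx.
  by apply/isomorphicP/isomorphic_P3; exists v, y, z; rewrite eq_sym.
have dis : C1 :&: C2 = set0.
  apply/setP => S; rewrite !inE; apply/andP => [[/imsetP [D D2 ->]]].
  move: D2; rewrite inE => /andP [sD D2] /imsetP [[y z]]; rewrite inE /= => /andP [/andP [vy yz] _] E.
  by move: D2; rewrite -(I1 D sD) E I2 // cards1.
rewrite cardsU dis cards0 subn0; congr (_ + _).
  rewrite -cards_draws card_in_imset // => D D'; rewrite !inE => /andP [sD _] /andP [sD' _] E.
  by rewrite -(I1 D sD) E I1.
rewrite card_in_imset => [|[y z] [y' z']]; last first.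
  rewrite !inE /= => /andP [/andP [vy yz] zv] /andP [/andP [vy' yz'] zv'] E.
  have yy : y = y'.
    by have := I2 y z vy yz; rewrite E I2 // => /setP /(_ y); rewrite !inE eqxx => /eqP.
  rewrite -yy in E *; congr (_, _).
  have nzy : z != y by rewrite eq_sym adj_neq.
  have /setP/(_ z) := E; rewrite !inE eqxx orbT (negbTE zv) (negbTE nzy) /=.
  by move=> /esym /eqP.
rewrite -sum1dep_card big_mkcond sum_prod [RHS]big_mkcond; apply: eq_bigr => y _.
rewrite inE /=; case vy: (adj v y) => /=; last by rewrite big1.
have := cardsD1 v (nbr y); rewrite inE adj_sym vy => -> /=.
rewrite -sum1_card [RHS]big_mkcond; apply: eq_bigr => z _.
by rewrite !inE andbC.
Qed.

End TriangleFree.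

(** * Degrees and irregularity for [n = 3] *)

Section P3.
Variable K : nat.
Hypothesis K_ge3 : 3 <= K.
Let G := graph false false K 1 1.
Local Notation uA := (vA false false 1 1).
Local Notation uB := (vB false false 1 1).
Local Notation uP := (vP false false K 1).
Local Notation uQ := (vQ false false K 1).

Lemma graph_triangle_free (x y z : G) : adj x y -> adj y z -> adj x z = false.
Proof. by case: x y z => [[x|x]|[x|x]] [[y|y]|[y|y]] [[z|z]|[z|z]] //=; rewrite ?(ord1 x) ?(ord1 y) ?(ord1 z). Qed.

Lemma sum_ltn_id q : \sum_(x < q) x = 'C(q, 2).
Proof. by rewrite -bin2_sum big_mkord. Qed.

Lemma card_nbr (v : G) : #|nbr v| = \sum_(w : G) adj v w.
Proof. by rewrite -sum1dep_card big_mkcond. Qed.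

Lemma nbr_A k : #|nbr (uA k : G)| = k.+1.
Proof.
rewrite card_nbr (@big_graph false false K 1 1) /= !big1_eq add0n !big_ord1 /= addn0 addn1.
by rewrite sum_lt // leq_ord.
Qed.

Lemma nbr_B (k : 'I_K) : #|nbr (uB k : G)| = (K - k).+1.
Proof.
rewrite card_nbr (@big_graph false false K 1 1) /= !big1_eq addn0 !big_ord1 /= add0n addn1.
by rewrite (sum_ge K.+1 k.+1).
Qed.

Lemma nbr_P l : #|nbr (uP l : G)| = K.+1.
Proof.
rewrite card_nbr (@big_graph false false K 1 1) /= !big1_eq !big_ord1 /= (ord1 l) /=.
by rewrite sum1_card card_ord !addn0.
Qed.

Lemma nbr_Q l : #|nbr (uQ l : G)| = K.
Proof.
rewrite card_nbr (@big_graph false false K 1 1) /= !big1_eq !big_ord1 /= (ord1 l) /=.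
by rewrite sum1_card card_ord !addn0.
Qed.

Lemma sub_degree3 (v : G) : sub_degree (path_graph 3) v = 'C(#|nbr v|, 2) +
  (\sum_(a < K.+1) adj v (uA a) * a
  + \sum_(b < K) adj v (uB b) * (K - b)
  + (adj v (uP ord0) * K + adj v (uQ ord0) * K.-1)).
Proof.
rewrite (sub_degree_P3 graph_triangle_free); congr (_ + _).
transitivity (\sum_(w : G) adj v w * #|nbr w|.-1).
  rewrite big_mkcond; apply: eq_bigr => w _; rewrite inE.
  by case: (adj v w); rewrite ?mul1n.
rewrite (@big_graph false false K 1 1) !big_ord1 nbr_P nbr_Q; congr (_ + _ + _).
  by apply: eq_bigr => a _; rewrite nbr_A.
by apply: eq_bigr => b _; rewrite nbr_B.
Qed.

Lemma sum_subn q : q <= K -> \sum_(c < q) (K - c) + 'C(q, 2) = q * K.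
Proof.
move=> le; rewrite -sum_ltn_id -big_split /= -[q in RHS]card_ord -sum_nat_const.
by apply: eq_bigr => c _; rewrite subnK // (leq_trans _ le) // ltnW.
Qed.

Lemma degree3_A k : sub_degree (path_graph 3) (uA k : G) = k.+1 * K.+1 - 1.
Proof.
rewrite sub_degree3 nbr_A /= [\sum_(a < K.+1) _]big1 // add0n mul1n mul0n addn0.
rewrite (sum_lt_mul (fun b => K - b) (leq_ord k)).
have := sum_subn (leq_ord k); rewrite binS bin1.
by move: (\sum_(c < k) _) => x; clear; lia.
Qed.

Lemma degree3_B (k : 'I_K) :
  sub_degree (path_graph 3) (uB k : G) = (K - k) * K.+1 + K.-1.
Proof.
rewrite sub_degree3 nbr_B /= [\sum_(b < K) _]big1 // addn0 mul1n mul0n add0n.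
have -> : \sum_(a < K.+1) (k < a) * a = \sum_(c < K - k) (K - c).
  rewrite (reindex_inj rev_ord_inj) /= -(@sum_lt_mul K.+1 _ (fun c => K - c)) ?leqW ?leq_subr //.
  by apply: eq_bigr => a _; rewrite subSS; have := leq_ord a; have := ltn_ord k; clear; lia.
have := sum_subn (leq_subr k K); rewrite binS bin1.
by move: (\sum_(c < _) _) => x; clear; lia.
Qed.

Lemma degree3_P l : sub_degree (path_graph 3) (uP l : G) = K * K.+1.
Proof.
rewrite sub_degree3 nbr_P /= (ord1 l) /= [\sum_(b < K) _]big1 // !mul0n !addn0.
under eq_bigr => a _ do rewrite mul1n.
have := triangular0 K.+1; rewrite !sum_ltn_id.
by move: 'C(_, _) => x; clear; lia.
Qed.

Lemma degree3_Q l : sub_degree (path_graph 3) (uQ l : G) = K * K.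
Proof.
rewrite sub_degree3 nbr_Q /= (ord1 l) /= [\sum_(a < K.+1) _]big1 // !mul0n !addn0 add0n.
under eq_bigr => b _ do rewrite mul1n.
by rewrite addnC sum_subn.
Qed.

Lemma graph3_irregular : irregular (path_graph 3) G.
Proof.
suff inj : injective (@sub_degree (path_graph 3) G) by move=> u v uv /inj.
have resid x y r s : r < K.+1 -> s < K.+1 -> x * K.+1 + r = y * K.+1 + s -> x = y /\ r = s.
  exact: mulnD_inj.
have dA a : sub_degree (path_graph 3) (uA a : G) = a * K.+1 + K.
  by rewrite degree3_A mulSn; clear; lia.
have dP l : sub_degree (path_graph 3) (uP l : G) = K * K.+1 + 0.
  by rewrite degree3_P addn0.
(* [K * K] is rewritten to expose residue 1 modulo [K.+1]; [3 <= K] separates it from the residue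
   [K.-1] on B. *)
have dQ l : sub_degree (path_graph 3) (uQ l : G) = K.-1 * K.+1 + 1.
  by rewrite degree3_Q; move: K_ge3; clear; nia.
have degE := (dA, degree3_B, dP, dQ).
move=> [[a|b]|[l|l]] [[a'|b']|[l'|l']].
all: rewrite -?/(uA _) -?/(uB _).
all: rewrite -?/(uP _) -?/(uQ _).
all: rewrite !degE.
all: try by (case/resid => [||_]; move: K_ge3; clear; lia).
all: try by rewrite (ord1 l) (ord1 l').
- by case/resid => // /val_inj ->.
- case/resid => [||E _]; try by (move: K_ge3; clear; lia).
  congr (vB _ _ _ _ _); apply/val_inj => /=.
  by have := ltn_ord b; have := ltn_ord b'; move: E; clear; lia.
Qed.

End P3.

Lemma isomorphic_card (F G : sgraph) : isomorphic F G -> #|F| = #|G|.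
Proof. by case=> f [/bij_eq_card]. Qed.

Lemma card_graph cliqueA cliqueB K t t' :
  #|graph cliqueA cliqueB K t t'| = K.+1 + K + (t + t').
Proof. by rewrite !card_sum !card_ord. Qed.

Theorem theorem1 (n : nat) (hn : 3 <= n) :
  exists G : nat -> sgraph,
    (forall k : nat, irregular (path_graph n) (G k)) /\
    (forall i j : nat, i <> j -> ~ isomorphic (G i) (G j)).
Proof.
case: n hn => [|[|[|[|m]]]] // _.
  exists (fun k => graph false false (k + 3) 1 1); split=> [k|i j ij].
    by apply: graph3_irregular; rewrite leq_addl.
  by move/isomorphic_card; rewrite !card_graph; lia.
(* The parameter [M = k + 3] satisfies [3 <= M], and different [k] give graphs of different
   order. *)
exists (fun k => graph true (m != 0) (1 + m.+3 * (k + 3)) m.+3 m.+2); split=> [k|i j ij].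
  by apply: (@graph_irregular m (k + 3)); rewrite ?leq_addl.
move/isomorphic_card; rewrite !card_graph => E.
have /eqP : m.+3 * (i + 3) = m.+3 * (j + 3) by move: E; clear; lia.
by rewrite eqn_pmul2l // eqn_add2r => /eqP.
Qed.
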